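(* Let $C$ be a finitely generated subgroup of infinite index in a free group $F=F(X)$ of finite rank. Then every Schreier transversal of $C$ in $F$ is a regular and thick subset of $F$.
   Context: $F=F(X)$ is the free group with finite basis $X=\{x_1,\dots,x_m\}$; elements of $F$ are identified with reduced words in the alphabet $X\cup X^{-1}$, and $|w|$ is the length of the reduced word $w$. A (right) transversal of $C$ is a set $S\subseteq F$ containing exactly one element from each right coset $Cu$, $u\in F$. A transversal $S$ is Schreier if every initial segment of (the reduced word representing) an element of $S$ belongs to $S$. A subset of $F$ is regular if, as a set of reduced words over $X\cup X^{-1}$, it is the language accepted by a finite deterministic automaton. For $s\in(0,1)$ let $\mu_s$ be the probability measure on $F$ given by $\mu_s(1)=s$ and $\mu_s(w)=\dfrac{s(1-s)^{|w|}}{2m(2m-1)^{|w|-1}}$ for $w\neq 1$, and $\mu_s(R)=\sum_{w\in R}\mu_s(w)$ for $R\subseteq F$. Put $\mu_0(R)=\lim_{s\to0^+}\mu_s(R)$ when this limit exists. A subset $R\subseteq F$ is thick if $\mu_0(R)$ exists and $\mu_0(R)>0$ (so that $\mu_s(R)=\mu_0(R)+\alpha_0(s)$ with $\lim_{s\to 0^+}\alpha_0(s)=0$). *)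

(* Defs.v *)
From HB Require Import structures.
From mathcomp Require Import all_boot all_order all_algebra.
From mathcomp Require Import all_classical all_reals all_analysis.
Set Implicit Arguments.
Unset Strict Implicit.
Unset Printing Implicit Defensive.
Import Order.TTheory GRing.Theory Num.Theory numFieldNormedType.Exports.

Local Open Scope classical_set_scope.
Local Open Scope group_scope.

(* The letter [(i, false)] stands for x_i and [(i, true)] for its inverse. *)
Definition letter (m : nat) : Type := ('I_m * bool)%type.
HB.instance Definition _ m := Finite.on (letter m).

Definition linv m (a : letter m) : letter m := (a.1, ~~ a.2).

(* No letter is immediately followed by its inverse. *)
Definition reduced m : pred (seq (letter m)) :=
  sorted (fun a b => b != linv a).

Record freegroup (m : nat) := FreeGroup {
  word :> seq (letter m);
  wordP : reduced word }.

HB.instance Definition _ m := [isSub for @word m].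
HB.instance Definition _ m := [Countable of freegroup m by <:].

(* Reduced form of the letter [a] followed by the reduced word [w]. *)
Definition lmul m (a : letter m) (w : seq (letter m)) : seq (letter m) :=
  if w is b :: w' then if b == linv a then w' else a :: w else [:: a].

Section FreeGroupLaws.
Variable m : nat.
Implicit Types (a b : letter m) (u v w : seq (letter m)).

Lemma linvK : involutive (@linv m).
Proof. by case=> i b; rewrite /linv /= negbK. Qed.

Lemma reduced_cons a w :
  reduced (a :: w) = (if w is b :: _ then b != linv a else true) && reduced w.
Proof. by case: w. Qed.

Lemma reduced_lmul a w : reduced w -> reduced (lmul a w).
Proof.
case: w => [//|b w] rw; rewrite /lmul; case: ifP => [_|/negbT ba].
  by move: rw; rewrite reduced_cons => /andP[].
by rewrite reduced_cons ba.
Qed.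

Lemma lmul_reduced a w : reduced (a :: w) -> lmul a w = a :: w.
Proof. by rewrite reduced_cons; case: w => //= b w /andP[/negbTE->]. Qed.

Lemma lmulK a w : reduced w -> lmul (linv a) (lmul a w) = w.
Proof.
case: w => [|b w] rw /=; first by rewrite linvK eqxx.
case: ifP => [/eqP eba|_]; last by rewrite /= linvK eqxx.
by rewrite lmul_reduced -?eba.
Qed.

Lemma reduced_foldr u w : reduced w -> reduced (foldr (@lmul m) w u).
Proof. by move=> rw; elim: u => //= a u; apply: reduced_lmul. Qed.

Lemma foldr_lmul a v w : reduced w ->
  foldr (@lmul m) w (lmul a v) = lmul a (foldr (@lmul m) w v).
Proof.
case: v => //= b v rw; case: ifP => //= /eqP->.
by rewrite -{1}[a]linvK lmulK ?reduced_foldr.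
Qed.

Lemma foldr_lmulA u v w : reduced w ->
  foldr (@lmul m) w (foldr (@lmul m) v u)
  = foldr (@lmul m) (foldr (@lmul m) w v) u.
Proof. by move=> rw; elim: u => //= a u IHu; rewrite foldr_lmul// IHu. Qed.

Lemma foldr_lmul_nil u : reduced u -> foldr (@lmul m) [::] u = u.
Proof.
elim: u => // a u IHu ru.
have := ru; rewrite reduced_cons => /andP[_ /IHu /= ->].
exact: lmul_reduced.
Qed.

Lemma reduced_inv u : reduced u -> reduced (rev (map (@linv m) u)).
Proof.
rewrite /reduced rev_sorted sorted_map; apply: sub_sorted => a b.
by rewrite /relpre /= linvK eq_sym.
Qed.

Lemma foldr_lmulV u w : reduced w ->
  foldr (@lmul m) (foldr (@lmul m) w u) (rev (map (@linv m) u)) = w.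
Proof.
elim: u w => //= a u IHu w rw.
by rewrite rev_cons -cats1 foldr_cat /= lmulK ?IHu ?reduced_foldr.
Qed.

End FreeGroupLaws.

Section FreeGroupInstance.
Variable m : nat.
Implicit Types x y z : freegroup m.

Definition fg_one : freegroup m := @FreeGroup m [::] isT.

(* Reduced form of the concatenation of [x] and [y]. *)
Definition fg_mul x y : freegroup m :=
  FreeGroup (reduced_foldr x (wordP y)).

Definition fg_inv x : freegroup m := FreeGroup (reduced_inv (wordP x)).

Lemma fg_mulA : associative fg_mul.
Proof. by move=> x y z; apply: val_inj; rewrite /= foldr_lmulA ?wordP. Qed.

Lemma fg_mul1 : left_id fg_one fg_mul.
Proof. by move=> x; apply: val_inj. Qed.

Lemma fg_mulr1 : right_id fg_one fg_mul.
Proof. by move=> x; apply: val_inj; rewrite /= foldr_lmul_nil ?wordP. Qed.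

Lemma fg_mulV : left_inverse fg_one fg_inv fg_mul.
Proof.
move=> x; apply: val_inj => /=.
by rewrite -{1}(foldr_lmul_nil (wordP x)) foldr_lmulV.
Qed.

Lemma fg_invK : involutive fg_inv.
Proof.
move=> x; apply: val_inj => /=.
by rewrite map_rev revK -map_comp map_id_in// => a _ /=; rewrite linvK.
Qed.

Lemma fg_mulrV : right_inverse fg_one fg_inv fg_mul.
Proof. by move=> x; rewrite -{1}[x]fg_invK fg_mulV. Qed.

HB.instance Definition _ := isGroup.Build (freegroup m)
  fg_mulA fg_mul1 fg_mulr1 fg_mulV fg_mulrV.

End FreeGroupInstance.

Section Subgroups.
Variable G : groupType.
Implicit Types C S : set G.

(* Contains 1 and is closed under [x, y |-> x * y^-1]. *)
Definition is_subgroup C := group_closed [in C].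

Definition generated_subgroup (B : set G) : set G := smallest is_subgroup B.

Definition finitely_generated C :=
  exists2 B, finite_set B & C = generated_subgroup B.

Definition right_coset C (u : G) : set G := [set c * u | c in C].

Definition infinite_index C := infinite_set (range (right_coset C)).

Definition right_transversal C S :=
  forall u, exists! v, S v /\ right_coset C u v.

End Subgroups.

Definition schreier_transversal m (C S : set (freegroup m)) :=
  right_transversal C S /\
  forall u v : freegroup m, S v -> prefix u v -> S u.

Record dfa (A : Type) := Dfa {
  dfa_state : finType;
  dfa_init : dfa_state;
  dfa_final : pred dfa_state;
  dfa_trans : dfa_state -> A -> dfa_state }.

Definition dfa_accept A (M : dfa A) (w : seq A) : bool :=
  dfa_final (foldl (@dfa_trans A M) (dfa_init M) w).

Definition regular_language A (L : set (seq A)) :=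
  exists M : dfa A, L = [set w | dfa_accept M w].

Definition regular_subset m (S : set (freegroup m)) :=
  regular_language [set word w | w in S].

Section Thickness.
Variables (R : realType) (m : nat).
Local Open Scope ring_scope.

Definition mu_weight (s : R) (w : freegroup m) : R :=
  if nilp w then s else
  s * (1 - s) ^+ size w / (2 * m%:R * (2 * m%:R - 1) ^+ (size w).-1).

(* mu_s(S), as the supremum of the finite partial sums; this is the sum of the
   family for 0 < s < 1 and m > 0, where all weights are nonnegative. *)
Definition mu (s : R) (S : set (freegroup m)) : \bar R :=
  \esum_(w in S) (mu_weight s w)%:E.

(* mu_0(S) exists and equals l; the limit is taken in the extended reals, but l
   is required to be finite. *)
Definition has_mu0 (S : set (freegroup m)) (l : R) :=
  mu s S @[s --> 0^'+] --> l%:E.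

Definition thick (S : set (freegroup m)) :=
  exists2 l : R, has_mu0 S l & 0 < l.

End Thickness.

(* Main.v *)
Require Import Defs.
From mathcomp Require Import all_boot all_order all_algebra.
From mathcomp Require Import all_classical all_reals all_analysis.
From mathcomp Require Import ring lra.

(** View [C] through its graph of right cosets, with base vertex [C] and an edge
    labelled [a] from [C u] to [C u a]. The generators of [C] are loops at the
    base vertex; they cover a finite subgraph, the core, outside which the graph
    consists of trees hanging from the core. A Schreier transversal [S] is the
    set of paths from the base vertex in some spanning tree, and a spanning tree
    must contain every hanging tree. So as soon as an element of [S] has left
    the core, all its reduced extensions belong to [S].

    The algebraic form of this is short. Reduced words of [C] stay in the core
    ([core_prefix]), and if [v] is in [S] but a reduced word [v a] is not, then
    [v] is a prefix of an element of [C] ([schreier_extend]). Only finitely many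
    elements of [S] lie in the core, so there is a depth [N > 0] such that a
    reduced word is in [S] exactly when its prefix of length [N] (the word
    itself, if it is shorter) is in [S]: this is [schreier_determined].

    Both conclusions hold for any infinite set of that kind. An automaton that
    remembers the first [N] letters, the last letter and whether the word is
    reduced recognises it ([determined_regular]). The proportion of the reduced
    words of length [n] that lie in [S] is the same for all [n >= N], so
    [mu s S] is a polynomial in [s] whose value at [0] is this proportion
    ([mu_determined]); it is positive because [S] is infinite
    ([determined_thick]), which is where the infinite index is used. *)

Set Implicit Arguments.
Unset Strict Implicit.
Import Order.TTheory GRing.Theory Num.Theory numFieldNormedType.Exports.
Local Open Scope classical_set_scope.

(** * Elements of the free group as values of arbitrary words *)

Section Words.
Local Open Scope group_scope.
Variable m : nat.
Implicit Types (a b : letter m) (u v w : seq (letter m)) (x y : freegroup m).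

Lemma reduced_cat u v : reduced (u ++ v) -> reduced u /\ reduced v.
Proof. by case/cat_sorted2. Qed.

Lemma reduced_take n w : reduced w -> reduced (take n w).
Proof. by rewrite -{1}(cat_take_drop n w) => /reduced_cat[]. Qed.

Lemma reduced_rcons w a :
  reduced (rcons w a) =
  reduced w && (if w is b :: w' then a != linv (last b w') else true).
Proof. by case: w => //= b w; rewrite /reduced /= rcons_path. Qed.

(** The element represented by a word that need not be reduced. *)
Definition elt w : freegroup m :=
  FreeGroup (reduced_foldr w (isT : reduced [::])).

Lemma word_elt w : reduced w -> word (elt w) = w.
Proof. exact: foldr_lmul_nil. Qed.

Lemma elt_word x : elt x = x.
Proof. by apply: val_inj; apply: word_elt; exact: wordP. Qed.

Lemma elt_cat u v : elt (u ++ v) = elt u * elt v.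
Proof.
apply: val_inj => /=.
have rv : reduced (foldr (@lmul m) [::] v) by apply: reduced_foldr.
by rewrite foldr_cat foldr_lmulA // foldr_lmul_nil.
Qed.

Lemma elt_cons a w : elt (a :: w) = elt [:: a] * elt w.
Proof. by rewrite -cat1s elt_cat. Qed.

Lemma elt_rcons w a : elt (rcons w a) = elt w * elt [:: a].
Proof. by rewrite -cats1 elt_cat. Qed.

Lemma elt1 : elt [::] = 1.
Proof. exact: val_inj. Qed.

Lemma elt_linv a : elt [:: linv a] = (elt [:: a])^-1.
Proof. exact: val_inj. Qed.

Lemma elt_inv w : elt (rev (map (@linv m) w)) = (elt w)^-1.
Proof.
elim: w => [|a w IHw]; first by rewrite /= elt1 invg1.
by rewrite /= rev_cons elt_rcons IHw elt_linv [in RHS]elt_cons invgM.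
Qed.

Lemma elt_lmul a w : elt (lmul a w) = elt [:: a] * elt w.
Proof.
rewrite -elt_cons; case: w => //= b w; case: eqP => [->|//].
by rewrite (elt_cons a) (elt_cons (linv a)) elt_linv mulgA mulgV mul1g.
Qed.

Definition prefix_determined (N : nat) (S : set (freegroup m)) :=
  forall w : freegroup m, S w <-> S (elt (take N w)).

End Words.

(** * Paths in the coset graph *)

Section Paths.
Local Open Scope group_scope.
Variables (m : nat) (K : set (freegroup m)).
Implicit Types (a b : letter m) (u v w : seq (letter m)) (x y q : freegroup m).

(** The path that starts at [q] and reads [w] visits only points of [K]. *)
Definition stays q w := forall i, K (q * elt (take i w)).

Lemma stays_start q w : stays q w -> K q.
Proof. by move=> /(_ 0); rewrite take0 elt1 mulg1. Qed.

Lemma stays_cons q a w :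
  stays q (a :: w) <-> K q /\ stays (q * elt [:: a]) w.
Proof.
split=> [h|[Kq h] [|i]].
- split=> [|i]; first exact: stays_start h.
  by have := h i.+1; rewrite /= elt_cons mulgA.
- by rewrite take0 elt1 mulg1.
- by rewrite /= elt_cons mulgA.
Qed.

Lemma stays_lmul q a w : stays q (a :: w) -> stays q (lmul a w).
Proof.
case: w => //= b w; case: eqP => [->|//].
by move=> /stays_cons[_ /stays_cons[_]]; rewrite elt_linv mulgK.
Qed.

(** Free reduction only removes backtracking, so the set of points visited
    can only shrink: the reduced product of two paths in [K] is again in [K]. *)
Lemma stays_mul q u v :
  stays q u -> stays (q * elt u) v -> stays q (foldr (@lmul m) v u).
Proof.
elim: u q => [|a u IHu] q; first by rewrite elt1 mulg1.
move=> /stays_cons[Kq hu] hv /=; apply: stays_lmul; apply/stays_cons.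
by split=> //; apply: IHu hu _; rewrite -mulgA -elt_cons.
Qed.

End Paths.

(** * The core of the coset graph *)

Section Core.
Local Open Scope group_scope.
Variables (m : nat) (C B : set (freegroup m)).
Hypothesis C_subgroup : is_subgroup C.
Hypothesis C_gen : C = generated_subgroup B.
Implicit Types (x y : freegroup m).

Lemma subgroup1 : C 1.
Proof. by case: C_subgroup => /set_mem. Qed.

Lemma subgroup_div x y : C x -> C y -> C (x * y^-1).
Proof.
by case: C_subgroup => _ h Cx Cy; apply/set_mem; apply: h; apply/mem_set.
Qed.

Lemma subgroup_inv x : C x -> C x^-1.
Proof. by move=> Cx; rewrite -[_^-1]mul1g; apply: subgroup_div => //; exact: subgroup1. Qed.

Lemma subgroup_mul x y : C x -> C y -> C (x * y).
Proof. by move=> Cx Cy; rewrite -[y]invgK; apply/subgroup_div/subgroup_inv. Qed.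

(** Representatives of the vertices of the Stallings graph of [C]: the points
    passed when the generators are read as loops based at the coset [C]. *)
Definition landmarks : set (freegroup m) :=
  [set p | p = 1 \/ exists b i, B b /\ p = elt (take i b)].

(** The union of the cosets that are vertices of the Stallings graph. *)
Definition core : set (freegroup m) :=
  [set x | exists2 p, landmarks p & C (x * p^-1)].

Lemma core_sub c x : C c -> core x -> core (c * x).
Proof. by move=> Cc [p lp Cp]; exists p => //; rewrite -mulgA; apply: subgroup_mul. Qed.

(** A reduced word of [C] is read along a loop inside the core: this holds for
    the generators, and the elements for which it holds form a subgroup, since
    reading an inverse traverses the loop backwards and a product of loops stays
    in the core after free reduction. *)
Lemma core_prefix c i : C c -> core (elt (take i c)).
Proof.
pose D : set (freegroup m) := [set x | C x /\ stays core 1 x].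
suff DC : C `<=` D by move=> /DC[_ /(_ i)]; rewrite mul1g.
rewrite C_gen; apply: smallest_sub => /=.
  have DV x : D x -> D x^-1.
    case=> Cx hx; split; first exact: subgroup_inv.
    move=> j; rewrite mul1g.
    have -> : word x^-1 = rev (map (@linv m) x) by [].
    rewrite take_rev -map_drop elt_inv.
    (* The prefixes of x^-1 visit the cosets of the prefixes of x. *)
    set k := (_ - _)%N.
    have -> : (elt (drop k x))^-1 = x^-1 * elt (take k x).
      rewrite -{2}[x]elt_word -{2}(cat_take_drop k x) elt_cat invgM.
      by rewrite mulgVK.
    by apply: core_sub; [exact: subgroup_inv | have := hx k; rewrite mul1g].
  have DM x y : D x -> D y -> D (x * y).
    case=> Cx hx [Cy hy]; split; first exact: subgroup_mul.
    apply: stays_mul => // j; rewrite mul1g elt_word.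
    by apply: core_sub => //; have := hy j; rewrite mul1g.
  split.
    apply/mem_set; split; first exact: subgroup1.
    by move=> j; rewrite mul1g /= elt1; exists 1; [left|rewrite mulgV; exact: subgroup1].
  move=> x y /set_mem Dx /set_mem Dy; apply/mem_set.
  by apply: DM => //; apply: DV.
move=> b Bb; split; first by rewrite C_gen; exact: sub_gen_smallest.
move=> j; rewrite mul1g; exists (elt (take j b)); last by rewrite mulgV; exact: subgroup1.
by right; exists b, j.
Qed.

Lemma finite_landmarks : finite_set B -> finite_set landmarks.
Proof.
move=> Bfin.
have -> : landmarks = [set 1] `|`
    \bigcup_(b in B) [set elt (take i b) | i in `I_(size b).+1].
  apply/seteqP; split=> p [->|]; [by left| |by left|].
    case=> b [i [Bb ->]]; right; exists b => //.
    case: (leqP i (size b)) => hi; first by exists i.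
    by exists (size b) => //=; rewrite take_size take_oversize // ltnW.
  by case=> b Bb [i _ <-]; right; exists b, i.
rewrite finite_setU; split; first exact: finite_set1.
by apply: bigcup_finite => // b _; apply: finite_image; exact: finite_II.
Qed.

End Core.

(** * Schreier transversals *)

Section Transversal.
Local Open Scope group_scope.
Variables (m : nat) (C S : set (freegroup m)).
Hypothesis C_subgroup : is_subgroup C.
Hypothesis S_schreier : schreier_transversal C S.
Implicit Types (x y t u v : freegroup m).

Lemma coset_in x y : right_coset C x y <-> C (y * x^-1).
Proof.
split=> [[c Cc <-]|Cc]; first by rewrite mulgK.
by exists (y * x^-1); rewrite ?mulgVK.
Qed.

Lemma transversal_inj u v : S u -> S v -> C (u * v^-1) -> u = v.
Proof.
move=> Su Sv Cuv; case: S_schreier => [tr _].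
have [t [_ ut]] := tr v.
rewrite -(ut u); last by split=> //; apply/coset_in.
by apply: ut; split=> //; apply/coset_in; rewrite mulgV; exact: subgroup1.
Qed.

Lemma transversal_ex x : exists t, S t /\ C (x * t^-1).
Proof.
case: S_schreier => [tr _]; have [t [[St /coset_in Ct] _]] := tr x.
by exists t; split=> //; rewrite -[x * _]invgK invgM invgK; exact: subgroup_inv.
Qed.

Lemma schreier_take n w : S w -> S (elt (take n w)).
Proof.
case: S_schreier => _ pc Sw; apply: (pc _ w) => //.
by rewrite word_elt ?prefix_take//; apply/reduced_take/wordP.
Qed.

(** Let [t] in [S] represent the coset of [u = v a]. If [t] ends in [a], then
    [t] without its last letter and [v] lie in [S] and in the same coset, so
    [t = u]. Otherwise nothing cancels in [u t^-1], which is an element of [C]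
    beginning with [v]. *)
Lemma schreier_extend u v (a : letter m) : S v -> word u = rcons v a ->
  S u \/ exists2 c, C c & prefix v c.
Proof.
move=> Sv Eu; have [t [St Ct]] := transversal_ex u.
have ru := wordP u; rewrite Eu in ru.
suff [[t' Et]|rc] : (exists t' : seq (letter m), word t = rcons t' a)
    \/ reduced (word u ++ word t^-1).
- left; have Sy : S (elt t').
    by have := schreier_take (size t') St; rewrite Et -cats1 take_size_cat.
  have Et' : t = elt t' * elt [:: a] by rewrite -elt_rcons -Et elt_word.
  have Eu' : u = v * elt [:: a].
    by rewrite -{1}[v]elt_word -elt_rcons -Eu elt_word.
  suff Ev : v = elt t' by rewrite Eu' Ev -Et'.
  apply: transversal_inj => //.
  by move: Ct; rewrite Et' Eu' invgM mulgA mulgK.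
- right; exists (u * t^-1) => //.
  have -> : u * t^-1 = elt (word u ++ word t^-1) by rewrite elt_cat !elt_word.
  by rewrite word_elt // Eu -cats1 -catA prefix_prefix.
have rt : reduced (word t^-1) := wordP _.
have Ei : word t^-1 = rev (map (@linv m) t) by [].
case/lastP Et : (word t) => [|t' b].
  by right; rewrite Ei Et cats0 Eu.
have [->|ba] := eqVneq b a; first by left; exists t'.
right; move: rt; rewrite Ei Et map_rcons rev_rcons Eu cat_rcons => rt.
move: ru rt; rewrite /reduced; case: (word v) => [|c v'] /= ru rt.
  by rewrite rt andbT; apply: contra ba => /eqP/(inv_inj (@linvK m))->.
rewrite cat_path; move: ru; rewrite rcons_path => /andP[-> h] /=.
rewrite h rt andbT /=; apply: contra ba => /eqP/(inv_inj (@linvK m))->.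
exact: eqxx.
Qed.

(** An element of [S] in the core is the representative of a landmark, and there
    are finitely many landmarks; let [N] exceed the lengths of their
    representatives. Then no element of [S] of length at least [N] is a prefix
    of an element of [C], so every one-letter reduced extension of it is in [S]. *)
Lemma schreier_determined : finitely_generated C ->
  exists2 N, (0 < N)%N & prefix_determined N S.
Proof.
case=> B Bfin C_gen.
have Lfin := finite_landmarks Bfin.
have [tau htau] := choice transversal_ex.
have [N hN] : exists N, forall p, landmarks B p -> (size (tau p) < N)%N.
  exists (\max_(p <- finmap.enum_fset (fset_set (landmarks B))) size (tau p)).+1 => p lp.
  rewrite ltnS; apply: (@leq_bigmax_seq _ _ xpredT (fun p => size (tau p))) => //.
  by rewrite in_fset_set // mem_set.
(* The successor makes the depth visibly positive. *)
exists N.+1 => // w; split=> [|Sw]; first exact: schreier_take.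
case: (leqP (size w) N.+1) => [hw|hw]; first by rewrite -[w]elt_word -(take_oversize hw).
suff ext n : (N < n <= size w)%N -> S (elt (take n w)).
  by rewrite -[w]elt_word -[word w]take_size; apply: ext; rewrite leqnn andbT ltnW.
elim: n => [//|n IHn] /andP[]; rewrite ltnS leq_eqVlt => /orP[/eqP <- //|ltNn] ltnw.
have Sn : S (elt (take n w)) by apply: IHn; rewrite ltNn ltnW.
have rn k : reduced (take k w) by apply/reduced_take/wordP.
have a0 : letter m by case: (word w) ltnw => //.
have [] // := @schreier_extend (elt (take n.+1 w)) _ (nth a0 w n) Sn.
  by rewrite !word_elt // (take_nth a0).
case=> c Cc /prefixP[z Ez].
have [p lp Cp] := core_prefix C_subgroup C_gen n Cc.
have := hN p lp.
have [St Ct] := htau p.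
suff -> : tau p = elt (take n w).
  by rewrite word_elt // size_take ltnw ltnNge ltnW.
apply/esym/transversal_inj => //.
move: Cp; rewrite Ez word_elt // take_size_cat ?size_take ?ltnw // => Cp.
by have := subgroup_mul C_subgroup Cp Ct; rewrite mulgA mulgVK.
Qed.

Lemma transversal_infinite : infinite_index C -> infinite_set S.
Proof.
move=> h fS; apply: h.
suff -> : range (right_coset C) = right_coset C @` S by exact: finite_image.
apply/seteqP; split=> _ [x _ <-]; last by exists x.
have [t [St Ct]] := transversal_ex x.
exists t => //; apply/seteqP; split=> y /coset_in Cy; apply/coset_in.
  by have := subgroup_div C_subgroup Cy Ct; rewrite invgM invgK mulgA mulgVK.
by have := subgroup_mul C_subgroup Cy Ct; rewrite mulgA mulgVK.
Qed.

End Transversal.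

(** * Prefix-determined sets are regular *)

Lemma size_take_leq (T : Type) n (s : seq T) : (size (take n s) <= n)%N.
Proof. by rewrite size_take_min geq_minl. Qed.

Section Regular.
Variables (m N : nat) (S : set (freegroup m)).
Hypothesis S_det : prefix_determined N S.

(** What a finite automaton can remember of the word read so far: its first [N]
    letters, its last letter, and whether it is reduced. *)
Definition prefix_state : finType := (N.-bseq (letter m) * option (letter m) * bool)%type.

Definition read (w : seq (letter m)) : prefix_state :=
  (Bseq (size_take_leq N w), ohead (rev w), reduced w).

Definition step (st : prefix_state) (a : letter m) : prefix_state :=
  let: (t, o, b) := st in
  (Bseq (size_take_leq N (rcons t a)), Some a,
   b && (if o is Some c then a != linv c else true)).

Definition truncation_dfa : dfa (letter m) :=
  {| dfa_state := prefix_state; dfa_init := read [::];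
     dfa_final := [pred st : prefix_state | st.2 && `[< S (elt st.1.1) >]];
     dfa_trans := step |}.

Lemma read_rcons w a : read (rcons w a) = step (read w) a.
Proof.
rewrite /read /step; congr (_, _, _).
- apply: val_inj => /=; case: (leqP (size w) N) => hw.
    by rewrite (take_oversize hw).
  rewrite -!cats1 takel_cat ?(ltnW hw)// takel_cat ?take_takel //.
  by rewrite size_take hw.
- by rewrite rev_rcons.
- rewrite reduced_rcons; case/lastP: w => // w c; rewrite rev_rcons /=.
  by congr (_ && _); case: w => //= b w; rewrite last_rcons.
Qed.

Lemma determined_regular : regular_subset S.
Proof.
exists truncation_dfa.
have E w : foldl step (read [::]) w = read w.
  by elim/last_ind: w => // w a IHw; rewrite foldl_rcons IHw read_rcons.
apply/seteqP; split=> w /=; rewrite /dfa_accept /= E /=.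
  by move=> [x Sx <-]; rewrite wordP /=; apply/asboolP; exact: (S_det x).1.
move=> /andP[rw /asboolP Sw]; exists (FreeGroup rw) => //.
exact: (S_det _).2.
Qed.

End Regular.

(** * Counting the elements of each length *)

Section Count.
Variables (m : nat) (S : set (freegroup m)).

Definition sphere n : set (freegroup m) := [set w | S w /\ size w = n].

(** The words of the sphere, kept as tuples so that they can be counted. *)
Definition sphere_words n : {set n.-tuple (letter m)} :=
  [set t : n.-tuple (letter m) | reduced t && `[< S (elt t) >]].

Lemma sphere_finite n : finite_set (sphere n).
Proof.
apply: (@sub_finite_set _ _ ((fun t : n.-tuple (letter m) => elt t) @` setT)).
  move=> w [_ Ew]; exists (tcast Ew (in_tuple w)) => //.
  by rewrite val_tcast elt_word.
exact: finite_image.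
Qed.

Lemma card_sphere n : size (finmap.enum_fset (fset_set (sphere n))) = #|sphere_words n|.
Proof.
rewrite cardE -[LHS](size_map (@word m)) -[RHS](size_map val).
apply/perm_size/uniq_perm.
- by rewrite map_inj_uniq; [exact: finmap.fset_uniq | exact: val_inj].
- by rewrite map_inj_uniq ?enum_uniq//; exact: val_inj.
move=> u; apply/mapP/mapP => -[x].
  rewrite in_fset_set; last exact: sphere_finite.
  move=> /set_mem[Sx Ex] ->; exists (tcast Ex (in_tuple x)); last by rewrite /= val_tcast.
  by rewrite mem_enum inE val_tcast wordP /= elt_word; apply/asboolP.
rewrite mem_enum inE => /andP[rx /asboolP Sx] ->; exists (elt x).
  rewrite in_fset_set; last exact: sphere_finite.
  by apply/mem_set; split=> //; rewrite word_elt // size_tuple.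
by rewrite word_elt.
Qed.

End Count.

Section Growth.
Variables (m N : nat) (S : set (freegroup m)).
Hypothesis S_det : prefix_determined N S.
Hypothesis N_gt0 : (0 < N)%N.

(** From length [N] on, each element of [S] has all its reduced one-letter
    extensions in [S], and there are [2 m - 1] of them: every letter but the
    inverse of the last one. *)
Lemma card_sphere_words_succ n : (N <= n)%N ->
  #|sphere_words S n.+1| = (#|sphere_words S n| * (2 * m).-1)%N.
Proof.
move=> Nn; case: n Nn => [|n] Nn; first by rewrite leqNgt N_gt0 in Nn.
pose chop (t : n.+2.-tuple (letter m)) : n.+1.-tuple (letter m) :=
  [tuple of belast (thead t) (behead t)].
have chopE (t : n.+1.-tuple (letter m)) a : chop [tuple of rcons t a] = t.
  apply: val_inj => /=; case: t => -[//|b t] ht /=.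
  by rewrite /thead (tnth_nth b) /= belast_rcons.
have ext (t : n.+1.-tuple (letter m)) a : ([tuple of rcons t a] \in sphere_words S n.+2)
    = (t \in sphere_words S n.+1) && (a != linv (last a t)).
  have rE : reduced (rcons t a) = reduced t && (a != linv (last a t)).
    by rewrite reduced_rcons; congr (_ && _); case: (t) => -[].
  have E : reduced (rcons t a) -> (S (elt (rcons t a)) <-> S (elt t)).
    move=> rta; have rt : reduced t by move: rta; rewrite rE => /andP[].
    suff Et : take N (elt (rcons t a)) = take N (elt t).
      by split=> h; apply: (S_det _).2; [rewrite -Et | rewrite Et];
        exact: (S_det _).1.
    by rewrite !word_elt // -cats1 takel_cat ?size_tuple.
  rewrite !finset.in_set; apply/idP/idP => [/andP[rta /asboolP/(E rta) St]|].
    by move: rta; rewrite rE => /andP[-> ->]; rewrite andbT; apply/asboolP.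
  move=> /andP[/andP[rt /asboolP St] ha].
  have rta : reduced (rcons t a) by rewrite rE rt.
  by apply/andP; split=> //; apply/asboolP/(E rta).
have surj (u : n.+2.-tuple (letter m)) : exists t a, u = [tuple of rcons (t : n.+1.-tuple (letter m)) a].
  exists (chop u), (last (thead u) u); apply: val_inj => /=.
  by case: u => -[//|b u] hu /=; rewrite /thead (tnth_nth b) /= -lastI.
rewrite -!sum1_card (partition_big chop [in sphere_words S n.+1]) /=; last first.
  by move=> u; have [t [a ->]] := surj u; rewrite ext chopE => /andP[].
rewrite big_distrl /=; apply: eq_bigr => t tS; rewrite mul1n.
have a0 : letter m := thead t.
rewrite sum1_card.
have -> : (2 * m).-1 = #|[set~ linv (last a0 t)]%SET|.
  by rewrite cardsC1 card_prod card_ord card_bool mulnC.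
have lastE a : last a t = last a0 t by case: (t) => -[].
rewrite -(card_imset (mem [set~ linv (last a0 t)]%SET) (f := fun a => [tuple of rcons t a])); last first.
  by move=> a b /(congr1 val) /= /rcons_inj[].
apply: eq_card => u; apply/andP/imsetP => [[uS /eqP Eu]|[a]].
  have [t' [a E]] := surj u; exists a; rewrite E in uS Eu *.
    by move: uS; rewrite chopE in Eu; rewrite Eu ext lastE !inE => /andP[].
  by rewrite chopE in Eu; rewrite Eu.
move=> ha ->; split; last by rewrite chopE.
by rewrite /= ext tS lastE; move: ha; rewrite !inE.
Qed.

End Growth.

(** * The measure of a prefix-determined set *)

Section Mass.
Local Open Scope ring_scope.
Variables (R : realType) (m : nat).
Implicit Types (S : set (freegroup m)) (s : R).

(** For [m > 0], the inverse of the number of reduced words of length [n]. *)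
Definition word_share n : R :=
  if n == 0%N then 1 else (2 * m%:R * (2 * m%:R - 1) ^+ n.-1)^-1.

Lemma mu_weightE s (w : freegroup m) :
  mu_weight s w = s * (1 - s) ^+ size w * word_share (size w).
Proof.
by rewrite /mu_weight /word_share /nilp; case: eqP => [->|_]; rewrite ?expr0 ?mulr1.
Qed.

Lemma word_share_ge0 n : 0 <= word_share n.
Proof.
rewrite /word_share; case: ifP => // _; rewrite invr_ge0.
case: (posnP m) => [->|m0]; first by rewrite !mulr0 mul0r.
have : (1 : R) <= m%:R by rewrite ler1n.
by move=> ?; apply: mulr_ge0; [|apply: exprn_ge0]; lra.
Qed.

Lemma mu_spheres S s : 0 <= s <= 1 ->
  mu s S = (\sum_(0 <= n <oo)
    (#|sphere_words S n|%:R * word_share n * (s * (1 - s) ^+ n))%:E)%E.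
Proof.
move=> /andP[s0 s1].
have w0 (w : freegroup m) : (0 <= (mu_weight s w)%:E)%E.
  by rewrite lee_fin mu_weightE !mulr_ge0 ?exprn_ge0 ?word_share_ge0 ?subr_ge0.
rewrite /mu; have {1}-> : S = \bigcup_n sphere S n.
  by apply/seteqP; split=> [w Sw|w [n _ []]//]; exists (size w).
rewrite esum_bigcupT //; last first.
  apply/trivIsetP => i j _ _ /eqP ij; apply/seteqP; split=> // w.
  by move=> [[_ Ei] [_ Ej]]; apply: ij; rewrite -Ei.
rewrite nneseries_esumT; last first.
  by move=> n; rewrite lee_fin !mulr_ge0 ?exprn_ge0 ?word_share_ge0 ?subr_ge0.
apply: eq_esum => n _.
have fin := sphere_finite S n.
rewrite esum_fset // fsbig_finite //= -(card_sphere S n).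
rewrite (eq_big_seq (fun=> (word_share n * (s * (1 - s) ^+ n))%:E)); last first.
  move=> w; rewrite in_fset_set // => /set_mem[_ Ew].
  by rewrite mu_weightE Ew mulrC.
rewrite sumEFin big_const_seq count_predT.
by rewrite iter_addr_0 -[in RHS]mulrA mulr_natl.
Qed.

End Mass.

Section Thick.
Local Open Scope ring_scope.
Variables (R : realType) (m N : nat) (S : set (freegroup m)).
Hypothesis S_det : prefix_determined N S.
Hypothesis N_gt0 : (0 < N)%N.

Lemma determined_finite : sphere_words S N = finset.set0 -> finite_set S.
Proof.
move=> S0.
apply: (@sub_finite_set _ _ (\bigcup_(n in `I_N) sphere S n)); last first.
  by apply: bigcup_finite; [exact: finite_II | move=> n _; exact: sphere_finite].
move=> w Sw; exists (size w) => //=; rewrite ltnNge; apply/negP => Nw.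
have st : size (take N w) == N by rewrite size_take_min; apply/eqP/minn_idPl.
suff : Tuple st \in sphere_words S N by rewrite S0 finset.in_set0.
rewrite finset.in_set /=; apply/andP; split; first exact/reduced_take/wordP.
by apply/asboolP; exact: (S_det w).1.
Qed.

(** The proportion of the reduced words of length [n] that lie in [S]. *)
Let share n : R := #|sphere_words S n|%:R * word_share R m n.

(** From one length to the next, starting at [N], the numbers of elements of [S]
    and of reduced words are both multiplied by [2 m - 1]. *)
Lemma share_stationary k : (0 < m)%N -> share (k + N) = share N.
Proof.
move=> m0; elim: k => // k <-; rewrite addSn /share.
rewrite (card_sphere_words_succ S_det N_gt0) ?leq_addl //.
rewrite /word_share.
case: (k + N)%N (leq_addl k N) => [|n] /= Nn; first by move: N_gt0; rewrite ltnNge Nn.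
have m1 : (1 : R) <= m%:R by rewrite ler1n.
rewrite natrM; have -> : (2 * m).-1%:R = 2 * m%:R - 1 :> R.
  by rewrite -subn1 natrB ?muln_gt0 ?m0 // natrM.
have d0 : 2 * m%:R - 1 != 0 :> R by apply/eqP; lra.
have m2 : m%:R != 0 :> R by apply/eqP; lra.
by rewrite exprS; field; rewrite d0 m2 expf_neq0.
Qed.

(** As the proportions are constant from [N] on, the tail of the series for the
    measure is geometric, with sum [share N * (1 - s) ^+ N]; the remaining terms
    are polynomials in [s], divisible by [s]. *)
Definition mass_poly : {poly R} :=
  \sum_(n < N) (share n)%:P * 'X * (1 - 'X) ^+ n + (share N)%:P * (1 - 'X) ^+ N.

Lemma mu_determined s : (0 < m)%N -> 0 < s < 1 -> mu s S = (mass_poly.[s])%:E.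
Proof.
move=> m0 /andP[s0 s1].
rewrite mu_spheres ?(ltW s0) ?(ltW s1) //.
have w0 n : 0 <= share n * (s * (1 - s) ^+ n).
  by rewrite /share !mulr_ge0 ?word_share_ge0 ?exprn_ge0 ?subr_ge0 ?(ltW s0) ?(ltW s1).
rewrite (nneseries_split 0 N) => [|n _]; last by rewrite lee_fin; exact: w0.
rewrite add0n sumEFin big_mkord -nneseries_addn => [|n]; last by rewrite lee_fin; exact: w0.
rewrite /mass_poly hornerD EFinD; congr (_ + _)%E.
  rewrite horner_sum; congr _%:E; apply: eq_bigr => n _.
  by rewrite !hornerE.
(* The right-hand side is the closed form a / (1 - z) of the sum of a geometric
   series, with ratio z = 1 - s. *)
have -> : ((share N)%:P * (1 - 'X) ^+ N).[s] = share N * (1 - s) ^+ N * s / (1 - (1 - s)).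
  by rewrite !hornerE; field; lra.
apply: cvg_lim => //.
have -> : (fun n => \sum_(0 <= k < n)
      (share (k + N) * (s * (1 - s) ^+ (k + N)))%:E)%E
  = EFin \o series (geometric (share N * (1 - s) ^+ N * s) (1 - s)).
  apply/funext => n; rewrite /= /series /= sumEFin; congr _%:E.
  by apply: eq_bigr => k _; rewrite share_stationary // exprD /=; ring.
apply/cvg_EFin; first by near=> x.
apply: cvg_geometric_series; rewrite ger0_norm; lra.
Unshelve. all: by end_near.
Qed.

(** The limit at [0] is the value of the polynomial there, [share N]. It is
    positive, because a set without elements of length [N] has no longer ones and
    is therefore finite. *)
Lemma determined_thick : infinite_set S -> thick R S.
Proof.
move=> Sinf.
have cardN : (0 < #|sphere_words S N|)%N.
  rewrite lt0n cards_eq0; apply/negP => /eqP S0.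
  exact: Sinf (determined_finite S0).
(* A word of length N > 0 has a letter, so the rank is positive. *)
have m0 : (0 < m)%N.
  have [t _] := card_gt0P cardN.
  by move: (tnth t (Ordinal N_gt0)).1 => i; exact: leq_ltn_trans (ltn_ord i).
exists (share N).
  have p0 : mass_poly.[0] = share N.
    rewrite !hornerE horner_sum big1 ?add0r => [|n _]; last by rewrite !hornerE ?mulr0 ?mul0r.
    by rewrite ?subr0 ?expr1n ?mulr1.
  rewrite /has_mu0 -p0.
  apply: (@cvg_trans _ ((mass_poly.[s])%:E @[s --> 0^'+])).
    apply: near_eq_cvg; near=> s; rewrite mu_determined //.
    by apply/andP; split; near: s; [exact: nbhs_right_gt | exact: nbhs_right_lt].
  apply: cvg_EFin; first by near=> s.
  apply: cvg_at_right_filter; exact: continuous_horner.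
have m1 : (1 : R) <= m%:R by rewrite ler1n.
rewrite mulr_gt0 // /word_share.
  by rewrite ltr0n.
rewrite eqn0Ngt N_gt0 /= invr_gt0 mulr_gt0 ?exprn_gt0; lra.
Unshelve. all: by end_near.
Qed.

End Thick.

Theorem proposition4p4 (R : realType) (m : nat) (C S : set (freegroup m))
    (C_subgroup : is_subgroup C) (C_fg : finitely_generated C)
    (C_index : infinite_index C) (S_schreier : schreier_transversal C S) :
  regular_subset S /\ thick R S.
Proof.
have [N N_gt0 S_det] := schreier_determined C_subgroup S_schreier C_fg.
split; first exact: determined_regular S_det.
apply: determined_thick S_det N_gt0 _.
exact: transversal_infinite C_subgroup S_schreier C_index.
Qed.
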